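(* Let $G=(V,E)$ be a graph of order $n$ with minimum degree $\delta(G)=2$, and let $C(G)$ be its coalition number. Then: (a) If $G$ contains exactly one full vertex $f$, then $C(G)=n$ if and only if $G[V\setminus\{f\}]\in\mathcal{F}_1$. (b) If $G$ contains exactly two full vertices, then $C(G)=n$ if and only if $G\cong (K_1\cup K_{n-3})+K_2$. (c) If $G$ contains at least three full vertices, then $G\cong C_3$.
   Context: All graphs are finite and simple. A full vertex is a vertex adjacent to all other vertices. A set $D\subseteq V$ is dominating if every vertex not in $D$ has a neighbor in $D$. Two disjoint sets $A,B\subseteq V$ form a coalition if neither is dominating but $A\cup B$ is. A coalition partition of $G$ is a partition $\mathcal{P}$ of $V$ such that every member is either a dominating set of cardinality 1, or is not dominating and forms a coalition with some other member of $\mathcal{P}$. The coalition number $C(G)$ is the maximum cardinality of a coalition partition of $G$. $\cup$ denotes disjoint union and $+$ denotes the join of graphs. The family $\mathcal{F}_1$: $G$ has vertex set $\{x,y,w\}\cup P\cup Q$, where $x,y,w$ are distinct, $P,Q$ are disjoint sets disjoint from $\{x,y,w\}$, $|P\cup Q|\ge 1$, and if $Q\neq\emptyset$ then $|Q|\ge 2$. Edges: $N(x)=\{y\}$; $N(w)=P\cup Q$; each $p\in P$ is adjacent to all vertices of $(P\cup Q)\setminus\{p\}$; if $Q\ne\emptyset$, $y$ is adjacent to all vertices of $Q$, and edges (possibly none) are added between vertices of $Q$ so that $G[Q]$ has no full vertex; finally any number of edges between $y$ and vertices of $P$ may be added. *)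

(* Defs.v *)
From mathcomp Require Import all_boot.

Set Implicit Arguments.
Unset Strict Implicit.
Unset Printing Implicit Defensive.

Record sgraph := SGraph {
  svertex :> finType;
  sedge : rel svertex;
  sedge_sym : symmetric sedge;
  sedge_irrefl : irreflexive sedge }.

Notation "x -- y" := (sedge x y) (at level 30, no associativity).

Section Basics.
Variable G : sgraph.

Definition neighborhood (v : G) : {set G} := [set u | v -- u].

Definition degree (v : G) : nat := #|neighborhood v|.

(* Every degree is smaller than #|G|, so for a nonempty graph the default value
   #|G| does not affect the minimum. *)
Definition min_degree : nat := \big[minn/#|G|]_(v : G) degree v.

Definition full_vertex (v : G) : bool := [forall u, (u != v) ==> (v -- u)].

Definition full_vertices : {set G} := [set v | full_vertex v].

Definition dominating (D : {set G}) : bool :=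
  [forall v, (v \notin D) ==> [exists u in D, v -- u]].

Definition coalition (A B : {set G}) : bool :=
  [&& [disjoint A & B], ~~ dominating A, ~~ dominating B
    & dominating (A :|: B)].

Definition coalition_partition (P : {set {set G}}) : bool :=
  partition P [set: G] &&
  [forall A in P,
     (dominating A && (#|A| == 1)) ||
     (~~ dominating A && [exists B in P :\ A, coalition A B])].

Definition coalition_number : nat :=
  \max_(P : {set {set G}} | coalition_partition P) #|P|.

End Basics.

Arguments full_vertices : clear implicits.

Section Induced.
Variables (G : sgraph) (S : {set G}).

Definition induced_rel : rel {v : G | v \in S} :=
  fun u v => val u -- val v.

Fact induced_sym : symmetric induced_rel.
Proof. by move=> u v; apply: sedge_sym. Qed.

Fact induced_irrefl : irreflexive induced_rel.
Proof. by move=> u; apply: sedge_irrefl. Qed.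

Definition induced : sgraph := SGraph induced_sym induced_irrefl.

End Induced.

Definition graph_iso (G H : sgraph) : Prop :=
  exists2 f : G -> H, bijective f & forall u v, (f u -- f v) = (u -- v).

Section Complete.
Variable n : nat.

Definition complete_rel : rel 'I_n := fun i j => i != j.

Fact complete_sym : symmetric complete_rel.
Proof. by move=> i j; rewrite /complete_rel eq_sym. Qed.

Fact complete_irrefl : irreflexive complete_rel.
Proof. by move=> i; rewrite /complete_rel eqxx. Qed.

Definition complete : sgraph := SGraph complete_sym complete_irrefl.

End Complete.

Section Cycle.
Variable n : nat.

(* This is the n-cycle for 3 <= n. *)
Definition cycle_rel : rel 'I_n :=
  fun i j => (i != j) && ((j == ordS i) || (i == ordS j)).

Fact cycle_sym : symmetric cycle_rel.
Proof. by move=> i j; rewrite /cycle_rel eq_sym orbC. Qed.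

Fact cycle_irrefl : irreflexive cycle_rel.
Proof. by move=> i; rewrite /cycle_rel eqxx. Qed.

Definition cycle_graph : sgraph := SGraph cycle_sym cycle_irrefl.

End Cycle.

Section UnionJoin.
Variables G H : sgraph.

(* b tells whether vertices of G are adjacent to vertices of H. *)
Definition sum_rel (b : bool) : rel (G + H) :=
  fun u v => match u, v with
             | inl x, inl y => x -- y
             | inr x, inr y => x -- y
             | _, _ => b
             end.

Fact sum_sym b : symmetric (sum_rel b).
Proof. by move=> [x|x] [y|y] //=; apply: sedge_sym. Qed.

Fact sum_irrefl b : irreflexive (sum_rel b).
Proof. by move=> [x|x] /=; apply: sedge_irrefl. Qed.

Definition disjoint_union : sgraph :=
  SGraph (sum_sym false) (sum_irrefl false).

Definition join : sgraph := SGraph (sum_sym true) (sum_irrefl true).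

End UnionJoin.

(* Edges between y and P, and inside Q apart from the absence of a full vertex
   of G[Q], are left unconstrained. *)
Definition family_F1 (G : sgraph) : Prop :=
  exists (x y w : G) (P Q : {set G}),
    [/\ uniq [:: x; y; w],
        [disjoint P & Q] /\ [disjoint P :|: Q & [set x; y; w]],
        [set x; y; w] :|: (P :|: Q) = [set: G],
        1 <= #|P :|: Q| /\ (Q != set0 -> 2 <= #|Q|)
      & [/\ neighborhood x = [set y],
            neighborhood w = P :|: Q,
            forall p u, p \in P -> u \in (P :|: Q) :\ p -> p -- u,
            Q != set0 -> forall q, q \in Q -> y -- q
          & Q != set0 -> full_vertices (induced Q) = set0]].

(* Main.v *)
Require Import Defs.
From mathcomp Require Import all_boot.
From mathcomp Require Import zify.

(** [C(G) = #|G|] holds exactly when the partition into singletons is a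
    coalition partition, i.e. when every non-full vertex forms a dominating pair
    with another non-full vertex.
    A vertex of degree 2 that is not full has at most two full neighbours, and
    one that is full forces [#|G| = 3].
    If a non-full one has two, every dominating pair of non-full
    vertices contains it, which forces the other non-full vertices to form a clique.
    If it has one, it becomes a leaf [x], with neighbour [y], once the full
    vertex is removed, and every dominating pair meets [{x, y}]. Hence any vertex
    [w <> y] not adjacent to [y] is adjacent to all vertices except [x] and [y].
    With such a [w] fixed, [P] consists of the vertices whose only
    non-neighbours lie in [{x, y}], and [Q] of the remaining ones. *)

Set Implicit Arguments.
Unset Strict Implicit.
Unset Printing Implicit Defensive.

(** * Dominating sets of size at most two, and coalition number equal to the order *)

Section Domination.
Variable G : sgraph.
Implicit Types u v : G.

Lemma full_vertexP v :
  reflect (forall u, u != v -> v -- u) (full_vertex v).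
Proof. by apply: (iffP forallP) => H u; [apply/implyP | apply/implyP/H]. Qed.

Lemma edge_neq u v : u -- v -> u != v.
Proof. by apply: contraTneq => ->; rewrite sedge_irrefl. Qed.

Lemma dominating2P u v :
  reflect (forall z, z != u -> z != v -> (u -- z) || (v -- z))
    (dominating [set u; v]).
Proof.
apply: (iffP forallP) => [H z zu zv | H z].
  have := H z; rewrite !inE negb_or zu zv /= => /existsP [w].
  by rewrite !inE => /andP[/orP[] /eqP-> ]; rewrite sedge_sym => ->; rewrite ?orbT.
apply/implyP; rewrite !inE negb_or => /andP[zu zv].
case/orP: (H z zu zv) => h; apply/existsP; [exists u | exists v].
  by rewrite !inE eqxx sedge_sym h.
by rewrite !inE eqxx orbT sedge_sym h.
Qed.

Lemma dominating1 v : dominating [set v] = full_vertex v.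
Proof.
rewrite -[[set v]]setUid; apply/dominating2P/full_vertexP => H u uv.
  by have := H u uv uv; rewrite orbb.
by rewrite H.
Qed.

(** The coalition condition for the partition into singletons: [v != u] is disjointness of the two
    blocks, and a singleton is dominating exactly when its vertex is full. *)
Definition singleton_coalitions :=
  forall u, ~~ full_vertex u ->
    exists v, [/\ v != u, ~~ full_vertex v & dominating [set u; v]].

Lemma card_partition_le (P : {set {set G}}) :
  partition P [set: G] -> #|P| <= #|G|.
Proof.
move=> partP; rewrite -cardsT (card_partition partP) -sum1_card.
by apply: leq_sum => A AP; rewrite card_gt0 (partition_neq0 partP).
Qed.

(** The block sizes are at least 1 and sum to the number of blocks, so every one of these bounds is
    an equality. *)
Lemma card_partition_eq (P : {set {set G}}) :
  partition P [set: G] -> #|P| = #|G| -> forall A, A \in P -> #|A| = 1.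
Proof.
move=> partP + A AP.
rewrite -cardsT (card_partition partP) -sum1_card => eq_sum.
have leP B : B \in P -> 1 <= #|B| ?= iff (#|B| == 1).
  move=> BP; apply/leqifP; case: ifP => [/eqP-> // | /negbT nB].
  by rewrite ltn_neqAle eq_sym nB card_gt0 (partition_neq0 partP).
have := leqif_sum leP => /leqifP; rewrite eq_sum.
case: ifP => [/forall_inP H _ | _]; last by rewrite ltnn.
by apply/eqP/H.
Qed.

Definition singletons : {set {set G}} := [set [set x] | x : G].

Lemma singletonsP : partition singletons [set: G].
Proof.
apply/and3P; split.
- apply/eqP/setP => x; rewrite inE; apply/bigcupP.
  by exists [set x]; rewrite ?set11 // imset_f.
- apply/trivIsetP => A B /imsetP[a _ ->] /imsetP[b _ ->] nab.
  by rewrite disjoints1 inE; apply: contra nab => /eqP->.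
- by apply/imsetP => -[x _ /setP/(_ x)]; rewrite !inE eqxx.
Qed.

Lemma card_singletons : #|singletons| = #|G|.
Proof. by rewrite card_imset //; apply: set1_inj. Qed.

(** With as many blocks as vertices, all blocks have one element, so the block of [u] is [[set u]]
    and its coalition partner is some [[set v]]. *)
Lemma coalition_partition_singletons (P : {set {set G}}) :
  coalition_partition P -> #|P| = #|G| -> singleton_coalitions.
Proof.
case/andP=> partP /forall_inP coalP cardP u nfu.
have card1 := card_partition_eq partP cardP.
have singP z : [set z] \in P.
  have: z \in cover P by rewrite (cover_partition partP).
  case/bigcupP=> A AP zA.
  by have /eqP/cards1P[a eA] := card1 A AP; move: AP zA; rewrite eA inE => + /eqP->.
have := coalP _ (singP u); rewrite dominating1 (negbTE nfu) /=.
case/existsP=> B /andP[/setD1P[nB BP]].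
have /eqP/cards1P[v eB] := card1 B BP.
rewrite /coalition eB !dominating1 => /and4P[_ _ nfv dom]; exists v; split=> //.
by apply: contra nB; rewrite eB => /eqP->.
Qed.

Lemma coalition_number_order :
  coalition_number G = #|G| <-> singleton_coalitions.
Proof.
split=> [eqC | sc].
  case: (pickP (fun P : {set {set G}} => coalition_partition P)) => [P0 cP0 | no].
    have [P cP eP] := @eq_bigmax_cond _ [pred P : {set {set G}} | coalition_partition P]
       (fun P => #|P|) (introT card_gt0P (ex_intro _ P0 cP0)).
    by apply: (coalition_partition_singletons cP); rewrite -eqC -eP.
  (* Without any coalition partition the maximum is 0, so there are no vertices and the condition is
     vacuous. *)
  move: eqC; rewrite /coalition_number big_pred0 // => /esym/card0_eq no_vertex u.
  by have := no_vertex u; rewrite inE.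
apply/eqP; rewrite eqn_leq; apply/andP; split.
  by apply/bigmax_leqP => P /andP[/card_partition_le].
rewrite -card_singletons; apply: leq_bigmax_cond.
rewrite /coalition_partition singletonsP /=; apply/forall_inP => A /imsetP[u _ ->].
rewrite dominating1 cards1 eqxx andbT.
have [//|/= nfu] := boolP (full_vertex u); have [v [nvu nfv dom]] := sc u nfu.
apply/existsP; exists [set v]; rewrite !inE imset_f // andbT.
have -> : [set v] != [set u] by apply: contra nvu => /eqP/set1_inj->.
by rewrite /coalition dom !dominating1 nfv nfu disjoints1 inE eq_sym nvu.
Qed.

End Domination.

(** * Full vertices in graphs of minimum degree 2 *)

Section MinDegree.
Variable G : sgraph.
Implicit Types u v f : G.

Lemma degree_lt_order v : degree v < #|G|.
Proof.
rewrite -cardsT; apply: proper_card; apply/properP; split; first exact: subsetT.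
by exists v; rewrite !inE ?sedge_irrefl.
Qed.

Lemma min_degree_le v : min_degree G <= degree v.
Proof.
rewrite /min_degree; have := mem_index_enum v.
elim: (index_enum G) => // u s IHs; rewrite inE big_cons geq_min.
by case/predU1P=> [<- | /IHs->]; rewrite ?leqnn ?orbT.
Qed.

Lemma min_degree_attained : 0 < #|G| -> exists v, degree v = min_degree G.
Proof.
case/card_gt0P=> v0 _.
(* The first alternative is the default value of the big operator; it is excluded since every degree
   is below the order. *)
have: min_degree G = #|G| \/ exists v, degree v = min_degree G.
  rewrite /min_degree; elim/big_ind: _ => [|m p Hm Hp|v _]; first by left.
    by rewrite /minn; case: ifP.
  by right; exists v.
case=> // eqG; have := min_degree_le v0.
by rewrite eqG leqNgt degree_lt_order.
Qed.

Lemma neighborhood_full f : full_vertex f -> neighborhood f = ~: [set f].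
Proof.
move/full_vertexP=> ff; apply/setP => u; rewrite !inE.
by apply/idP/idP => [/edge_neq | /ff]; rewrite // eq_sym.
Qed.

Lemma full_degree v : full_vertex v = (degree v == #|G|.-1).
Proof.
have sub : neighborhood v \subset ~: [set v].
  by apply/subsetP => u; rewrite !inE => /edge_neq; rewrite eq_sym.
apply/idP/idP => [/neighborhood_full | ].
  by rewrite /degree => ->; rewrite cardsC1.
rewrite /degree -(cardsC1 v) => /eqP eq_card.
have /eqP eqN : neighborhood v == ~: [set v] by rewrite eqEcard sub eq_card leqnn.
apply/full_vertexP => u uv; have : u \in neighborhood v by rewrite eqN !inE.
by rewrite inE.
Qed.

(** This bounds the number of full vertices by the degree of any non-full vertex. *)
Lemma full_vertices_adjacent v :
  ~~ full_vertex v -> full_vertices G \subset neighborhood v.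
Proof.
move=> nfv; apply/subsetP => f; rewrite !inE => ff.
rewrite sedge_sym; apply: (full_vertexP _ ff).
by apply: contraNneq nfv => ->.
Qed.

Hypothesis min_degree2 : min_degree G = 2.

Lemma exists_degree2 : exists v, degree v = 2.
Proof.
rewrite -min_degree2; apply: min_degree_attained; rewrite lt0n.
apply: contra_eqN min_degree2 => /eqP G0.
by rewrite /min_degree big_pred0 ?G0 // => v; have /card0_eq/(_ v) := G0; rewrite inE.
Qed.

Lemma full_of_order3 v : #|G| = 3 -> full_vertex v.
Proof.
move=> G3; rewrite full_degree; have := degree_lt_order v.
by have := min_degree_le v; rewrite min_degree2 G3; lia.
Qed.

Lemma order3_of_full_degree2 v : degree v = 2 -> full_vertex v -> #|G| = 3.
Proof. by rewrite full_degree => -> /eqP; lia. Qed.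

(** If a vertex of degree 2 were full, the order would be 3, and minimum degree 2 would make all
    three vertices full. *)
Lemma exists_nonfull_degree2 :
  #|full_vertices G| < 3 -> exists2 v : G, degree v = 2 & ~~ full_vertex v.
Proof.
move=> F3; have [v dv] := exists_degree2; exists v => //.
apply: contraL F3 => /(order3_of_full_degree2 dv) G3.
rewrite -leqNgt -G3 -cardsT; apply/subset_leq_card/subsetP => u _.
by rewrite inE full_of_order3.
Qed.

(** A non-full vertex of degree 2 would have all the full vertices among its two neighbours; so the
    vertex of degree 2 is full. *)
Lemma three_full_vertices :
  3 <= #|full_vertices G| -> #|G| = 3 /\ forall u : G, full_vertex u.
Proof.
move=> F3; have [v dv] := exists_degree2.
have G3 : #|G| = 3.
  apply: (order3_of_full_degree2 dv); apply: contraLR F3 => nfv.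
  rewrite -leqNgt -dv; exact: subset_leq_card (full_vertices_adjacent nfv).
by split=> // u; apply: full_of_order3.
Qed.

End MinDegree.

(** * Graphs determined up to isomorphism by a classification of their vertices *)

Lemma class_bijection (T A B : finType) (t : A -> T) (t' : B -> T) :
    (forall c, #|[set a | t a == c]| = #|[set b | t' b == c]|) ->
  exists2 g : A -> B, bijective g & forall a, t' (g a) = t a.
Proof.
move=> eq_class.
have /fin_all_exists[b0 _] a : exists b, t' b == t a.
  have : 0 < #|[set b | t' b == t a]|.
    by rewrite -eq_class; apply/card_gt0P; exists a; rewrite inE.
  by case/card_gt0P=> b; rewrite inE; exists b.
pose eA c := enum [set a | t a == c]; pose eB c := enum [set b | t' b == c].
(* The i-th element of each class of [A] goes to the i-th element of the same class of [B]; [b0 a]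
   serves only as the default of [nth]. *)
pose g a := nth (b0 a) (eB (t a)) (index a (eA (t a))).
have mem_eA a : a \in eA (t a) by rewrite mem_enum inE.
have size_eq c : size (eA c) = size (eB c) by rewrite -!cardE.
have ltg a : index a (eA (t a)) < size (eB (t a)) by rewrite -size_eq index_mem.
have tg a : t' (g a) = t a.
  by have := mem_nth (b0 a) (ltg a); rewrite mem_enum inE => /eqP.
exists g => //; apply: inj_card_bij.
  move=> a b eq_g; have eq_t : t a = t b by rewrite -!tg eq_g.
  have ltb : index b (eA (t a)) < size (eB (t a)) by rewrite eq_t.
  have := eq_g; rewrite /g (set_nth_default (b0 b) _ (ltg a)) -eq_t.
  move/eqP; rewrite nth_uniq ?enum_uniq // => /eqP eq_i.
  by rewrite -(nth_index a (mem_eA a)) eq_i nth_index // eq_t.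
(* Injectivity suffices because [A] and [B] have equal size, seen by summing over the classes. *)
rewrite -!sum1_card (partition_big t' predT) //= (partition_big t predT) //=.
apply: eq_leq; apply: eq_bigr => c _; rewrite !sum1_card.
by have := eq_class c; rewrite !cardsE => ->.
Qed.

(** Adjacency of distinct vertices depends only on their classes, so the class sizes determine the
    graph. *)
Definition class_graph (T : finType) (r : rel T) (G : sgraph) (t : G -> T) :=
  forall u v, (u -- v) = (u != v) && r (t u) (t v).

Lemma class_graph_iso (T : finType) (r : rel T) (G H : sgraph)
    (t : G -> T) (t' : H -> T) :
    class_graph r t -> class_graph r t' ->
    (forall c, #|[set u | t u == c]| = #|[set v | t' v == c]|) ->
  graph_iso G H.
Proof.
move=> cG cH /class_bijection[g bij_g tg]; exists g => // u v.
by rewrite cG cH !tg (inj_eq (bij_inj bij_g)).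
Qed.

Lemma full_edge (G : sgraph) (f u : G) : full_vertex f -> (f -- u) = (f != u).
Proof.
move/full_vertexP=> ff; apply/idP/idP => [/edge_neq // | fu].
by apply: ff; rewrite eq_sym.
Qed.

(** The 3-cycle is complete, so a single class describes both graphs. *)
Lemma iso_cycle3 (G : sgraph) :
  #|G| = 3 -> (forall u : G, full_vertex u) -> graph_iso G (cycle_graph 3).
Proof.
move=> G3 allf.
apply: (@class_graph_iso unit (fun _ _ => true) _ _ (fun=> tt) (fun=> tt)).
- by move=> u v; rewrite andbT full_edge.
- by case=> [[|[|[|?]]] ?] [[|[|[|?]]] ?].
- case; rewrite (_ : [set _ | _] = setT); last by apply/setP => u; rewrite !inE.
  by rewrite cardsT G3 (_ : [set _ | _] = setT) ?cardsT ?card_ord.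
Qed.

(** * Exactly two full vertices *)

Section TwoFullVertices.

Definition pendant_join (n : nat) : sgraph :=
  join (disjoint_union (complete 1) (complete (n - 3))) (complete 2).

Definition pendant_class n (w : pendant_join n) : option bool :=
  match w with
  | inl (inl _) => Some true
  | inl (inr _) => Some false
  | inr _ => None
  end.

(** [None] is the class of the joined [K_2], adjacent to everything; the two [Some] classes are the
    cliques of the disjoint union, with no edges between them. *)
Definition pendant_rel : rel (option bool) := fun a b =>
  if (a, b) is (Some c, Some d) then c == d else true.

Lemma pendant_join_class n : class_graph pendant_rel (@pendant_class n).
Proof. by move=> [[u|u]|u] [[v|v]|v]; rewrite /= ?andbT. Qed.

Lemma card_pendant_class n c :
  #|[set w | @pendant_class n w == c]| =
    if c is Some b then if b then 1 else n - 3 else 2.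
Proof.
have cardE (T : finType) k (g : T -> pendant_join n) : injective g -> #|T| = k ->
    [set w | @pendant_class n w == c] = g @: setT ->
  #|[set w | @pendant_class n w == c]| = k.
  by move=> inj_g <- ->; rewrite card_imset // cardsT.
case: c cardE => [[]|] cardE.
- apply: (cardE 'I_1 _ (fun i => inl (inl i))); rewrite ?card_ord //.
    by move=> ? ? [].
  apply/setP => -[[w|w]|w]; rewrite inE /=; apply/esym.
  + by rewrite imset_f.
  + by apply/imsetP => -[].
  + by apply/imsetP => -[].
- apply: (cardE 'I_(n - 3) _ (fun i => inl (inr i))); rewrite ?card_ord //.
    by move=> ? ? [].
  apply/setP => -[[w|w]|w]; rewrite inE /=; apply/esym.
  + by apply/imsetP => -[].
  + by rewrite imset_f.
  + by apply/imsetP => -[].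
- apply: (cardE 'I_2 _ (fun i => inr i)); rewrite ?card_ord //.
    by move=> ? ? [].
  apply/setP => -[[w|w]|w]; rewrite inE /=; apply/esym.
  + by apply/imsetP => -[].
  + by apply/imsetP => -[].
  + by rewrite imset_f.
Qed.

Variable G : sgraph.
Implicit Types u v z : G.

Lemma two_full_class_graph v :
    #|full_vertices G| = 2 -> degree v = 2 -> ~~ full_vertex v ->
    singleton_coalitions G ->
  class_graph pendant_rel (fun u => if full_vertex u then None else Some (u == v)).
Proof.
move=> F2 dv nfv sc.
have Nv u : v -- u -> full_vertex u.
  (* The two full vertices are neighbours of [v], which has only two. *)
  have /eqP eqN : full_vertices G == neighborhood v.
    by rewrite eqEcard full_vertices_adjacent //= -/(degree v) dv F2 leqnn.
  by have /setP/(_ u) := eqN; rewrite !inE => ->.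
have clique u z : ~~ full_vertex u -> u != v -> ~~ full_vertex z -> z != v ->
    z != u -> u -- z.
  (* The partner [t] of [u] must be [v], since otherwise [v] would have the non-full neighbour [u]
     or [t]. As [v] is not adjacent to the non-full [z], the vertex [u] is. *)
  move=> nfu uv nfz zv zu; have [t [tu nft /dominating2P dom]] := sc u nfu.
  have [eq_tv | tv] := eqVneq t v.
    move: (dom z zu); rewrite eq_tv zv => /(_ isT)/orP[// | /Nv fz].
    by rewrite fz in nfz.
  move: (dom v); rewrite eq_sym uv eq_sym tv => /(_ isT isT).
  rewrite ![_ -- v]sedge_sym => /orP[] /Nv ful.
    by rewrite ful in nfu.
  by rewrite ful in nft.
move=> u z; have [fu | nfu] := ifPn; first by rewrite andbT full_edge.
have [fz | nfz] := ifPn; first by rewrite andbT sedge_sym full_edge // eq_sym.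
rewrite /=; have [-> | uv] := eqVneq u v; have [-> | zv] := eqVneq z v.
- by rewrite sedge_irrefl.
- by rewrite andbF; apply: contraNF nfz => /Nv.
- by rewrite andbF sedge_sym; apply: contraNF nfu => /Nv.
- rewrite andbT; apply/idP/idP => [/edge_neq // | uz].
  by apply: clique; rewrite // eq_sym.
Qed.

(** The single vertex [a] of class [Some true] is a partner of every other non-full vertex: together
    they cover both cliques. *)
Lemma pendant_class_coalitions (t : G -> option bool) :
    class_graph pendant_rel t -> #|[set u | t u == Some true]| = 1 ->
  singleton_coalitions G.
Proof.
move=> cG /eqP/cards1P[a ta].
have taE u : (t u == Some true) = (u == a).
  by have /setP/(_ u) := ta; rewrite !inE.
have ta1 : t a = Some true by apply/eqP; rewrite taE.
have tF u : ~~ full_vertex u -> u != a -> t u = Some false.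
  rewrite -taE => nfu; case tu: (t u) => [[]|] // _; case/full_vertexP: nfu => z zu.
  by rewrite cG tu eq_sym zu.
have dom u : ~~ full_vertex u -> u != a -> dominating [set u; a].
  move=> nfu ua; apply/dominating2P => z zu za; rewrite !cG ta1 (tF u nfu ua).
  rewrite ![_ == z]eq_sym zu za /=; move: za; rewrite -taE.
  by case: (t z) => [[]|].
have nonadj u : t u = Some false -> (a -- u) = false.
  by move=> tu; rewrite cG ta1 tu andbF.
move=> u nfu; have [ua | ua] := eqVneq u a.
  (* A partner for [a] itself is any of its non-neighbours, which cannot be full. *)
  have /forallPn[z] := nfu; rewrite negb_imply => /andP[zu nuz].
  have za : z != a by rewrite -ua.
  have nfz : ~~ full_vertex z.
    by apply: contra nuz => fz; rewrite sedge_sym full_edge.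
  by exists z; split=> //; rewrite setUC ua dom.
exists a; split; [by rewrite eq_sym | | exact: dom].
by apply: contraFN (nonadj u (tF u nfu ua)) => fa; rewrite full_edge // eq_sym.
Qed.

Lemma two_full_vertices (min_degree_G : min_degree G = 2) :
    #|full_vertices G| = 2 ->
  singleton_coalitions G <-> graph_iso G (pendant_join #|G|).
Proof.
move=> F2; split=> [sc | [g bij_g isog]].
  have [|v dv nfv] := exists_nonfull_degree2 min_degree_G; first by rewrite F2.
  pose t u := if full_vertex u then None else Some (u == v).
  have cardN : #|[set u | t u == None]| = 2.
    by rewrite -F2; apply: eq_card => u; rewrite !inE /t; case: ifP.
  have cardT : #|[set u | t u == Some true]| = 1.
    rewrite -(cards1 v); apply: eq_card => u; rewrite !inE /t.
    case: ifPn => [fu | _]; last by case: (u == v).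
    by apply/esym/eqP => uv; rewrite -uv fu in nfv.
  apply: (class_graph_iso (two_full_class_graph F2 dv nfv sc) (@pendant_join_class _)).
  move=> c; rewrite card_pendant_class; case: c => [[]|] //.
  (* The two full vertices and [v] account for the 3, so the subtraction in [n - 3] does not
     truncate. *)
  have : #|G| = #|[set u | t u == Some false]| + 3.
    have <- : #|~: full_vertices G :\ v| = #|[set u | t u == Some false]|.
      apply: eq_card => u; rewrite !inE /t.
      by case: ifP => _; rewrite ?andbF //; case: (u == v).
    by rewrite -(cardsC (full_vertices G)) F2 (cardsD1 v (~: _)) !inE nfv; lia.
  by move=> ->; rewrite addnK.
apply: (@pendant_class_coalitions (fun u => pendant_class (g u))).
  by move=> u v; rewrite -isog pendant_join_class (inj_eq (bij_inj bij_g)).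
have := card_pendant_class #|G| (Some true); rewrite -(on_card_preimset (f := g)).
  by move=> <-; apply: eq_card => u; rewrite !inE.
by apply: onW_bij.
Qed.

End TwoFullVertices.

(** * Graphs without full vertices that have a leaf, and the family [family_F1] *)

Section LeafGraph.
Variable G : sgraph.
Implicit Types u v w x y z : G.

Lemma leaf_family_F1 x y :
    neighborhood x = [set y] -> (forall u, ~~ full_vertex u) ->
    (forall u, exists v, u -- v) -> singleton_coalitions G ->
  family_F1 G.
Proof.
move=> Nx no_full no_isolated sc.
have xE z : (x -- z) = (z == y) by have /setP/(_ z) := Nx; rewrite !inE.
have xy : x -- y by rewrite xE.
(* The pair of [u] and its partner must dominate [x], whose only neighbour is [y]; hence the partner
   is [x] or [y]. *)
have partner u : u != x -> u != y -> dominating [set u; x] || dominating [set u; y].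
  move=> ux uy; have [t [tu _ dom]] := sc u (no_full u).
  have [<- | tx] := eqVneq t x; first by rewrite dom.
  have /dominating2P/(_ x) := dom; rewrite ![x == _]eq_sym ux tx => /(_ isT isT).
  by rewrite ![_ -- x]sedge_sym !xE (negbTE uy) => /eqP <-; rewrite dom orbT.
(* Neither [x] nor [y] is adjacent to [a], so in the dominating pair containing [u] it is [u] that
   dominates [a]. *)
have nonadj a u : a != y -> ~~ (y -- a) -> u != x -> u != y -> u != a -> a -- u.
  move=> ay nya ux uy ua; rewrite sedge_sym.
  have ax : a != x by apply: contraNneq nya => ->; rewrite (sedge_sym y).
  case/orP: (partner u ux uy) => /dominating2P/(_ a); rewrite eq_sym ua.
    by rewrite ax xE (negbTE ay) orbF; apply.
  by rewrite ay (negbTE nya) orbF; apply.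
have /forallPn[w] := no_full y; rewrite negb_imply => /andP[wy nyw].
have wx : w != x by apply: contraNneq nyw => ->; rewrite (sedge_sym y).
pose R := ~: [set x; y; w].
have RE u : (u \in R) = [&& u != x, u != y & u != w].
  by rewrite !inE !negb_or andbA.
pose P := [set p in R | [forall u in R :\ p, p -- u]].
pose Q := R :\: P.
have PQ : P :|: Q = R.
  have /setIidPr PR : P \subset R by apply/subsetP => u; rewrite inE => /andP[].
  by rewrite -{1}PR setID.
have adjP p u : p \in P -> u \in R -> u != p -> p -- u.
  by rewrite inE => /andP[_ /forall_inP H] uR up; apply: H; rewrite in_setD1 up.
(* A non-neighbour of [q] in [R] cannot lie in [P]. This gives both the size bound on [Q] and the
   absence of a full vertex in the graph induced on it. *)
have nonadjQ q : q \in Q -> exists u, [/\ u \in Q, u != q & ~~ (q -- u)].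
  rewrite in_setD => /andP[+ qR]; rewrite inE qR /= => /forall_inPn[u /setD1P[uq uR] nqu].
  exists u; split=> //; rewrite in_setD uR andbT; apply: contra nqu => uP.
  by rewrite sedge_sym adjP // eq_sym.
have Nw : neighborhood w = R.
  apply/setP => u; rewrite RE inE; apply/idP/and3P => [wu | [ux uy uw]].
    split; last by rewrite eq_sym edge_neq.
      by apply: contraTneq wu => ->; rewrite sedge_sym xE.
    by apply: contraTneq wu => ->; rewrite sedge_sym.
  exact: nonadj.
exists x, y, w, P, Q; rewrite PQ; split.
- by rewrite /= !inE !negb_or edge_neq //= ![_ == w]eq_sym wx wy.
- by split; rewrite disjoints_subset ?setCK // /Q setCD subsetUr.
- by rewrite setUCr.
- split.
    have [u wu] := no_isolated w; rewrite -Nw card_gt0; apply/set0Pn.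
    by exists u; rewrite inE.
  case/set0Pn=> q qQ; have [u [uQ uq _]] := nonadjQ q qQ.
  by apply/card_gt1P; exists u, q.
- split=> // [p u pP /setD1P[up uR] | _ q qQ | _]; first exact: adjP.
    have := qQ; rewrite in_setD => /andP[qP qR].
    have := qR; rewrite RE => /and3P[qx qy qw].
    (* If [y] were not adjacent to [q], then by [nonadj] the vertex [q] would be adjacent to all
       others in [R], hence in [P]. *)
    apply: contraNT qP => nyq; rewrite inE qR; apply/forall_inP => u /setD1P[uq].
    by rewrite RE => /and3P[ux uy _]; apply: nonadj.
  apply/setP => -[q qQ]; rewrite !inE; apply/full_vertexP => full_q.
  have [u [uQ uq /negP[]]] := nonadjQ q qQ.
  exact: (full_q (exist _ u uQ)).
Qed.

(** Explicit partners: [w] for [x] and for [y], [x] for [w] and for each vertex of [P], and [y] for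
    each vertex of [Q]. *)
Lemma family_F1_coalitions :
  (forall u, ~~ full_vertex u) -> family_F1 G -> singleton_coalitions G.
Proof.
move=> no_full [x [y [w [P [Q [uniq3 _ cover _ [Nx Nw adjP adjQ _]]]]]]].
move: uniq3; rewrite /= !inE negb_or andbT => /andP[/andP[xy xw] yw].
have inE5 z : [|| z == x, z == y, z == w, z \in P | z \in Q].
  have : z \in [set: G] by [].
  by rewrite -cover !inE -!orbA.
have yx : y -- x by rewrite sedge_sym; have /setP/(_ y) := Nx; rewrite !inE eqxx.
have wE z : (w -- z) = (z \in P) || (z \in Q).
  by have /setP/(_ z) := Nw; rewrite !inE.
have adjQ' q : q \in Q -> y -- q by move=> qQ; apply: adjQ => //; apply/set0Pn; exists q.
have adjP' p z : p \in P -> (z \in P) || (z \in Q) -> z != p -> p -- z.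
  by move=> pP zPQ zp; apply: adjP; rewrite // !inE zp.
have dom_xw : dominating [set x; w].
  apply/dominating2P => z zx zw; have := inE5 z.
  rewrite (negbTE zx) (negbTE zw) /= => /orP[/eqP-> | zPQ].
    by rewrite sedge_sym yx.
  by rewrite wE zPQ orbT.
have dom_yw : dominating [set y; w].
  apply/dominating2P => z zy zw; have := inE5 z.
  rewrite (negbTE zy) (negbTE zw) /= => /orP[/eqP-> | zPQ]; first by rewrite yx.
  by rewrite wE zPQ orbT.
have dom_px p : p \in P -> dominating [set p; x].
  move=> pP; apply/dominating2P => z zp zx; have := inE5 z.
  rewrite (negbTE zx) /= => /or3P[/eqP-> | /eqP-> | zPQ].
  - by rewrite [x -- _]sedge_sym yx orbT.
  - by rewrite sedge_sym wE pP.
  - by rewrite adjP'.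
have dom_qy q : q \in Q -> dominating [set q; y].
  move=> qQ; apply/dominating2P => z zq zy; have := inE5 z.
  rewrite (negbTE zy) /= => /or4P[/eqP-> | /eqP-> | zP | zQ].
  - by rewrite yx orbT.
  - by rewrite sedge_sym wE qQ orbT.
  - by rewrite sedge_sym adjP' // ?qQ ?orbT // eq_sym.
  - by rewrite adjQ' ?orbT.
have xnadj q : q != y -> ~~ (x -- q).
  by move=> qy; have /setP/(_ q) := Nx; rewrite !inE => ->.
move=> u _; case/or4P: (inE5 u) => [/eqP-> | /eqP-> | /eqP-> | /orP[uP | uQ]].
- by exists w; rewrite eq_sym xw.
- by exists w; rewrite eq_sym yw.
- by exists x; rewrite xw setUC.
- exists x; rewrite dom_px // no_full; split=> //.
  (* A vertex of [P] is adjacent to [w], whereas the only neighbour of [x] is [y]. *)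
  apply/eqP => xu; have : w -- x by rewrite wE xu uP.
  by rewrite sedge_sym (negbTE (xnadj w _)) // eq_sym.
- exists y; rewrite dom_qy // no_full; split=> //.
  by apply/eqP => yu; have := adjQ' u uQ; rewrite yu sedge_irrefl.
Qed.

End LeafGraph.

(** * Exactly one full vertex: reduction to the graph with it removed *)

Section OneFullVertex.
Variable G : sgraph.
Implicit Types u v x y z : G.

Variable f : G.
Hypothesis full_f : full_vertices G = [set f].

Let H := induced (~: [set f]).

Lemma full_vertexE u : full_vertex u = (u == f).
Proof. by have /setP/(_ u) := full_f; rewrite !inE. Qed.

Lemma val_neq_full (u : H) : val u != f.
Proof. by have := valP u; rewrite !inE. Qed.

Lemma exists_val u : u != f -> exists u' : H, val u' = u.
Proof.
move=> uf; have uS : u \in ~: [set f] by rewrite !inE.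
by exists (exist _ u uS).
Qed.

Lemma full_adj u : u != f -> u -- f.
Proof. by move=> uf; rewrite sedge_sym full_edge ?full_vertexE // eq_sym. Qed.

(** A full vertex of [H] is also adjacent to [f], hence full in [G], contradicting uniqueness of
    [f]. *)
Lemma induced_no_full (u : H) : ~~ full_vertex u.
Proof.
apply: contra (val_neq_full u) => /full_vertexP full_u.
rewrite -full_vertexE; apply/full_vertexP => z; have [-> _ | zf] := eqVneq z f.
  exact: full_adj (val_neq_full u).
by have [z' <-] := exists_val zf; apply: full_u.
Qed.

(** The only additional vertex to dominate in [G] is [f], which is adjacent to every vertex of
    [H]. *)
Lemma induced_dominating2 (u v : H) :
  dominating [set u; v] = dominating [set val u; val v].
Proof.
apply/dominating2P/dominating2P => [dom z | dom z]; last exact: (dom (val z)).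
have [-> _ _ | zf] := eqVneq z f; first by rewrite full_adj ?val_neq_full.
by have [z' <-] := exists_val zf; apply: dom.
Qed.

Lemma induced_singleton_coalitions :
  singleton_coalitions G <-> singleton_coalitions H.
Proof.
split=> sc u.
  have [|v []] := sc (val u); first by rewrite full_vertexE val_neq_full.
  rewrite full_vertexE => vu /exists_val[v' eq_v]; rewrite -eq_v in vu *.
  rewrite -induced_dominating2 => dom; exists v'; rewrite induced_no_full.
  by split=> //; apply: contraNneq vu => ->.
rewrite full_vertexE => /exists_val[u' <-].
have [v [vu _ dom]] := sc u' (induced_no_full u').
exists (val v); rewrite full_vertexE val_neq_full -induced_dominating2 dom.
by rewrite (inj_eq val_inj) vu.
Qed.

(** Removing [f] lowers every other degree by one: a non-full vertex of degree 2 becomes a leaf, and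
    minimum degree 2 leaves no isolated vertex. *)
Lemma one_full_vertex (min_degree_G : min_degree G = 2) :
  singleton_coalitions G <-> family_F1 H.
Proof.
rewrite induced_singleton_coalitions; split; last first.
  exact: family_F1_coalitions induced_no_full.
have [|x dx] := exists_nonfull_degree2 min_degree_G; first by rewrite full_f cards1.
rewrite full_vertexE => xf; have [x' x'E] := exists_val xf.
have card_nbr v : v != f -> degree v = #|neighborhood v :\ f|.+1.
  by move=> vf; rewrite /degree (cardsD1 f) inE full_adj.
have /eqP/cards1P[y Ny] : #|neighborhood x :\ f| = 1.
  by apply/eqP; rewrite -eqSS -card_nbr // dx.
have /exists_val[y' y'E] : y != f.
  have : y \in neighborhood x :\ f by rewrite Ny set11.
  by case/setD1P.
apply: (@leaf_family_F1 _ x' y'); last first.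
- move=> u; have : 0 < #|neighborhood (val u) :\ f|.
    have := min_degree_le (val u).
    by rewrite min_degree_G card_nbr ?val_neq_full.
  case/card_gt0P=> v /setD1P[/exists_val[v' <-]]; rewrite inE => uv.
  by exists v'.
- exact: induced_no_full.
apply/setP => z; rewrite !inE -val_eqE /= y'E.
have /setP/(_ (val z)) := Ny; rewrite !inE val_neq_full /= => <-.
by rewrite -x'E.
Qed.

End OneFullVertex.

Theorem theorem6 (G : sgraph) (n : nat) (order_G : #|G| = n)
    (min_degree_G : min_degree G = 2) :
  [/\ forall f : G, full_vertices G = [set f] ->
        (coalition_number G = n <-> family_F1 (induced (~: [set f]))),
      #|full_vertices G| = 2 ->
        (coalition_number G = n <->
         graph_iso G
           (join (disjoint_union (complete 1) (complete (n - 3))) (complete 2)))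
    & 3 <= #|full_vertices G| -> graph_iso G (cycle_graph 3)].
Proof.
rewrite -order_G; split=> [f full_f | F2 | F3].
- rewrite coalition_number_order; exact: one_full_vertex.
- rewrite coalition_number_order; exact: two_full_vertices.
- by have [G3 full] := three_full_vertices min_degree_G F3; apply: iso_cycle3.
Qed.
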